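(* Let $d\ge 2$ be fixed. There is a constant $C_d$ (depending only on $d$) such that for every positive integer $n$ there exists an $n$-point set $S\subset\mathbb{R}^d$ in convex position such that every point $p\in\mathbb{R}^d$ is contained in at most $\left(\frac{n}{d+1}\right)^{d+1}+C_d\, n^{d}$ of the $d$-simplices spanned by $S$.
   Context: A $d$-simplex spanned by $S$ is the convex hull of a $(d+1)$-element subset of $S$; a point $p$ is contained in it if $p$ belongs to this (closed) convex hull. The count is over $(d+1)$-element subsets of $S$. A finite set is in convex position if no point of it lies in the convex hull of the others. *)

(* Defs.v *)
From HB Require Import structures.
From mathcomp Require Import all_boot all_order all_algebra.
From mathcomp Require Import boolp reals.
Set Implicit Arguments. Unset Strict Implicit. Unset Printing Implicit Defensive.
Import Order.TTheory GRing.Theory Num.Theory.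
Local Open Scope ring_scope.

Definition in_hull (R : realType) (d n : nat) (f : 'I_n -> 'rV[R]_d)
    (T : {set 'I_n}) (p : 'rV[R]_d) : Prop :=
  exists w : 'I_n -> R,
    [/\ (forall i, 0 <= w i), (forall i, i \notin T -> w i = 0),
        \sum_i w i = 1 & \sum_i w i *: f i = p].

Definition convex_position (R : realType) (d n : nat) (f : 'I_n -> 'rV[R]_d) : Prop :=
  forall i, ~ in_hull f (~: [set i]) (f i).

Definition num_simplices_containing (R : realType) (d n : nat)
    (f : 'I_n -> 'rV[R]_d) (p : 'rV[R]_d) : nat :=
  #|[set T : {set 'I_n} | (#|T| == d.+1) && `[< in_hull f T p >]]|.

(* Main.v *)
Require Import Defs.
From HB Require Import structures.
From mathcomp Require Import all_boot all_order all_algebra.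
From mathcomp Require Import boolp reals.
From mathcomp Require Import lra.
Import Order.TTheory GRing.Theory Num.Theory.
Local Open Scope ring_scope.

(** The points lie on the curve [t |-> (b_1^t, ..., b_d^t)], where each base
    [b_(j+1)] is much larger than [b_j^n]; put [b_0 = 1].  Fix [p], and say
    that [t] is near [p] in coordinate [j] when [b_j^t] and [p_j] differ by less
    than about a factor [b_j]: at most two [t] are near for each [j], so the
    simplices with a near vertex number only [O(n^d)].  Any other [t] is far
    above or far below [p] in each coordinate; let its level be the largest
    coordinate in which it is above (0 if there is none).  If [p] lies in a
    simplex without near vertices then each of the [d+1] levels is attained by
    a vertex, for otherwise some coordinate of the convex combination would be
    smaller than that of [p].  Such simplices are therefore transversals of the
    level partition, and AM-GM bounds their number by [(n/(d+1))^(d+1)].  The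
    same domination argument in two coordinates gives convex position. *)

(** * Counting subsets: sets meeting a small set, and transversals of a partition *)

Lemma leq_ffact_exp n d : (n ^_ d <= n ^ d)%N.
Proof.
elim: d => [|d IHd]; first by rewrite ffactn0 expn0.
by rewrite ffactnSr expnSr leq_mul // leq_subr.
Qed.

Lemma leq_bin_exp n d : ('C(n, d) <= n ^ d)%N.
Proof.
apply: leq_trans (leq_ffact_exp n d).
by rewrite -bin_ffact leq_pmulr // fact_gt0.
Qed.

(** Such a set splits as a point of [N] and [d] further points, the latter chosen in at most [n ^ d]
    ways. *)
Lemma card_subsets_meeting {n : nat} (N : {set 'I_n}) (d : nat) :
  (#|[set T : {set 'I_n} | (#|T| == d.+1) && (T :&: N != set0)]|
     <= #|N| * n ^ d)%N.
Proof.
pose D := [set T : {set 'I_n} | #|T| == d].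
have cardD : (#|D| <= n ^ d)%N by rewrite card_draws card_ord leq_bin_exp.
apply: (@leq_trans #|[set x |: T | x in N, T in D]|)%N; last first.
  rewrite curry_imset2X; apply: leq_trans (leq_imset_card _ _) _.
  by rewrite cardsX leq_mul2l cardD orbT.
apply/subset_leq_card/subsetP => T; rewrite inE => /andP[/eqP cT /set0Pn[x]].
rewrite inE => /andP[xT xN]; apply/imset2P; exists x (T :\ x) => //.
  by rewrite inE; move: (cardsD1 x T); rewrite xT cT add1n => -[<-].
by rewrite setD1K.
Qed.

(** With one vertex chosen in each of the [d.+1] levels, the choice is injective, so it exhausts
    [T]; thus [T] is the image of an element of the product of the fibres. *)
Lemma card_transversals {n d : nat} (lev : 'I_n -> 'I_d.+1) :
  (#|[set T : {set 'I_n} | (#|T| == d.+1)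
        && [forall j, [exists t in T, lev t == j]]]|
     <= \prod_(j < d.+1) #|[set t | lev t == j]|)%N.
Proof.
pose F (j : 'I_d.+1) := mem [set t | lev t == j].
rewrite (_ : (\prod_j _)%N = #|family F|); last first.
  by rewrite card_family foldrE big_map big_enum.
apply: (@leq_trans
  #|[set [set g j | j in 'I_d.+1] | g : {ffun 'I_d.+1 -> 'I_n} in family F]|);
  last exact: leq_imset_card.
apply/subset_leq_card/subsetP => T.
rewrite inE => /andP[/eqP cT /forallP levT].
have [g gP] : exists g : {ffun 'I_d.+1 -> 'I_n},
    forall j, (g j \in T) && (lev (g j) == j).
  have ch j : {t | (t \in T) && (lev t == j)}.
    by apply: sigW; apply/existsP; apply: levT.
  by exists [ffun j => sval (ch j)] => j; rewrite ffunE; apply: (svalP (ch j)).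
apply/imsetP; exists g.
  by apply/familyP => j; rewrite inE /=; case/andP: (gP j).
have g_inj : injective g.
  by move=> i j eqg; move/andP: (gP i) => [_ /eqP <-];
     rewrite eqg; move/andP: (gP j) => [_ /eqP].
apply/esym/eqP; rewrite eqEcard; apply/andP; split.
  by apply/subsetP => _ /imsetP[j _ ->]; case/andP: (gP j).
by rewrite card_imset // cT cardE size_enum_ord.
Qed.

Lemma prod_fibers_le (R : realType) {n d : nat} (lev : 'I_n -> 'I_d.+1) :
  (\prod_(j < d.+1) #|[set t | lev t == j]|)%:R
    <= (n%:R / d.+1%:R) ^+ d.+1 :> R.
Proof.
have AG := leif_AGM (F := R) (I := 'I_d.+1) (A := predT)
  (E := fun j : 'I_d.+1 => #|[set t | lev t == j]|%:R).
rewrite natr_prod; apply: le_trans (leif_le (AG _)) _ => [j _|].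
  exact: ler0n.
rewrite -natr_sum card_ord (_ : (\sum_(j in predT) _)%N = n) //.
rewrite -[RHS]card_ord -sum1_card (partition_big lev predT) //=.
by apply: eq_bigr => j _; rewrite -sum1_card; apply: eq_bigl => t; rewrite inE.
Qed.

(** * Rapidly growing bases and the diagonal points in homogeneous coordinates *)

Section Bases.
Variables (R : realType) (n : nat).

(** The factor [2 * n.+1%:R] makes [n] error terms of size [base j ^+ n / base j.+1] add up to less
    than [1 / 2]. *)
Fixpoint base (j : nat) : R :=
  if j is i.+1 then 2 * n.+1%:R * base i ^+ n else 1.
Arguments base : simpl never.

Lemma baseS j : base j.+1 = 2 * n.+1%:R * base j ^+ n.
Proof. by []. Qed.

Lemma base_ge1 j : 1 <= base j.
Proof.
elim: j => // j IHj; rewrite baseS; have h : 1 <= base j ^+ n by exact: exprn_ege1.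
have : 1 <= n.+1%:R :> R by rewrite ler1n.
nra.
Qed.

Lemma base_gt0 j : 0 < base j.
Proof. exact: lt_le_trans (base_ge1 j). Qed.

Lemma base_gt j : 2 * (n%:R * base j ^+ n) < base j.+1.
Proof.
rewrite baseS -mulrA ltr_pM2l // ltr_pM2r ?ltr_nat //.
by rewrite exprn_gt0 // base_gt0.
Qed.

Lemma baseS_ge2 j : 2 <= base j.+1.
Proof.
have h : 1 <= base j ^+ n by apply: exprn_ege1; apply: base_ge1.
have : 1 <= n.+1%:R :> R by rewrite ler1n.
rewrite baseS; nra.
Qed.

Lemma base_leS j : (0 < n)%N -> base j <= base j.+1.
Proof.
move=> n0; have h : base j <= base j ^+ n by rewrite ler_eXnr // base_ge1.
have h1 := base_ge1 j.
have : 1 <= n.+1%:R :> R by rewrite ler1n.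
rewrite baseS; nra.
Qed.

Lemma base_le j k : (0 < n)%N -> (j <= k)%N -> base j <= base k.
Proof.
move=> n0; elim: k => [|k IHk]; first by rewrite leqn0 => /eqP->.
rewrite leq_eqVlt => /predU1P[-> //|/IHk h].
exact: le_trans h (base_leS k n0).
Qed.

Definition stretched_diagonal (d : nat) (i : 'I_n) : 'rV[R]_d :=
  \row_(k < d) base k.+1 ^+ i.

(* [hcoord p] is [p] in homogeneous coordinates: [base 0 = 1] makes coordinate
   [0] of every diagonal point equal to [1], and the hull equations, including
   the normalisation of the weights, all take the same form. *)
Definition hcoord {d : nat} (p : 'rV[R]_d) (j : 'I_d.+1) : R :=
  if unlift ord0 j is Some k then p 0 k else 1.

Lemma in_hull_hcoord {d : nat} (T : {set 'I_n}) (p : 'rV[R]_d) :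
  in_hull (stretched_diagonal d) T p ->
  exists w : 'I_n -> R,
    [/\ forall i, 0 <= w i, forall i, i \notin T -> w i = 0 &
        forall j : 'I_d.+1, \sum_i w i * base j ^+ i = hcoord p j].
Proof.
case=> w [w0 wT w1 wp]; exists w; split=> // j; rewrite /hcoord.
case: unliftP => [k|] -> /=.
  rewrite -wp summxE; apply: eq_bigr => i _.
  by rewrite !mxE.
by rewrite -[RHS]w1; apply: eq_bigr => i _; rewrite expr1n mulr1.
Qed.

Section Hull.
Variables (d : nat) (T : {set 'I_n}) (p : 'rV[R]_d).
Hypothesis pT : in_hull (stretched_diagonal d) T p.

Lemma hull_hcoord_ge1 j : 1 <= hcoord p j.
Proof.
have [w [w0 wT wp]] := in_hull_hcoord _ _ pT.
have w1 := wp ord0; rewrite {1}/hcoord unlift_none in w1.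
rewrite -w1 -(wp j); apply: ler_sum => i _; rewrite expr1n.
by apply: ler_wpM2l => //; apply: exprn_ege1; apply: base_ge1.
Qed.

(* A vertex far above [p] in a later coordinate has weight at most
   [1 / base j.+1], so its contribution to coordinate [j] is negligible; the
   remaining vertices only reach half of coordinate [j] of [p]. *)
Lemma hull_vertex (j : 'I_d.+1) :
  exists2 t, t \in T & hcoord p j < 2 * base j ^+ t
    /\ forall k : 'I_d.+1, (j < k)%N -> base k ^+ t < base k * hcoord p k.
Proof.
have [w [w0 wT wp]] := in_hull_hcoord _ _ pT.
have w1 := wp ord0; rewrite {1}/hcoord unlift_none in w1.
have {w1} w1 : \sum_i w i = 1.
  by rewrite -w1; apply: eq_bigr => i _; rewrite expr1n mulr1.
apply: contrapT => noT.
have P1 := hull_hcoord_ge1 j.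
have term i : w i * base j ^+ i
    <= w i * (hcoord p j / 2) + base j ^+ n / base j.+1.
  have eps0 : 0 <= base j ^+ n / base j.+1.
    by rewrite divr_ge0 ?exprn_ge0 // ltW // base_gt0.
  have [iT|/wT ->] := boolP (i \in T); last by rewrite !mul0r add0r.
  have [low|high] := lerP (2 * base j ^+ i) (hcoord p j).
    apply: ler_wpDr => //; apply: ler_wpM2l => //; lra.
  have [k jk ki] : exists2 k : 'I_d.+1, (j < k)%N
      & base k * hcoord p k <= base k ^+ i.
    apply: contrapT => nok; apply: noT; exists i => //; split=> // k jk.
    by rewrite ltNge; apply/negP => ki; apply: nok; exists k.
  have n0 : (0 < n)%N by apply: leq_ltn_trans (ltn_ord i).
  (* One nonnegative term of coordinate [k] is at most the whole sum; as [base k ^+ i] is at least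
     [base k * hcoord p k], dividing leaves a weight of at most [1 / base k]. *)
  have wk : w i * base k ^+ i <= hcoord p k.
    rewrite -(wp k) (bigD1 i) //= lerDl sumr_ge0 // => l _.
    by rewrite mulr_ge0 // exprn_ge0 // ltW // base_gt0.
  have wb : w i * base k <= 1.
    have Pk : 0 < hcoord p k by apply: lt_le_trans (hull_hcoord_ge1 k).
    rewrite -(ler_pM2r Pk) mul1r -mulrA; apply: le_trans wk.
    exact: ler_wpM2l.
  apply: ler_wpDl; first by rewrite mulr_ge0 //; lra.
  rewrite ler_pdivlMr ?base_gt0 // mulrAC.
  have wb' : w i * base j.+1 <= 1.
    by apply: le_trans wb; apply: ler_wpM2l => //; apply: base_le.
  have bjn : base j ^+ i <= base j ^+ n.
    by apply: ler_weXn2l; [apply: base_ge1|apply: ltnW].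
  apply: le_trans bjn; rewrite ler_piMl // exprn_ge0 // ltW // base_gt0 //.
have : hcoord p j <= hcoord p j / 2 + n%:R * base j ^+ n / base j.+1.
  rewrite -[X in X <= _]wp; apply: le_trans (ler_sum _ (fun i _ => term i)) _.
  rewrite big_split /= -mulr_suml w1 mul1r sumr_const card_ord.
  by rewrite -mulrA mulr_natl.
have : n%:R * base j ^+ n / base j.+1 < 1 / 2.
  rewrite ltr_pdivrMr ?base_gt0 //; have := base_gt j; lra.
lra.
Qed.

End Hull.

(** * Convex position *)

Lemma hcoord_stretched_diagonal d (i : 'I_n) (j : 'I_d.+1) :
  hcoord (stretched_diagonal d i) j = base j ^+ i.
Proof.
rewrite /hcoord; case: unliftP => [k|] -> /=; last by rewrite expr1n.
by rewrite mxE.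
Qed.

(** Were point [i] in the hull of the others, some [t != i] would satisfy both bounds of
    [hull_vertex]: coordinate 2 forces [t <= i], while coordinate 1 forces [i <= t]. *)
Lemma stretched_diagonal_convex d :
  (2 <= d)%N -> convex_position (stretched_diagonal d).
Proof.
case: d => [|[|d]] // _ i /hull_vertex.
move=> /(_ (Ordinal (isT : 1 < d.+3)%N)) [t].
rewrite !inE => ti [+ /(_ (Ordinal (isT : 2 < d.+3)%N) isT)].
rewrite !hcoord_stretched_diagonal -exprS /=.
move=> low high.
have b2 := baseS_ge2 0.
have b2' := baseS_ge2 1.
have : (t < i.+1)%N.
  rewrite ltnNge; apply/negP => it; move: high; rewrite ltNge => /negP; apply.
  by apply: ler_weXn2l => //; lra.
rewrite ltnS leq_eqVlt (negPf (_ : (t != i :> nat))) //= => ti'.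
move: low; rewrite ltNge => /negP; apply.
apply: (@le_trans _ _ (base 1 ^+ t.+1)).
  by rewrite exprS ler_pM2r // exprn_gt0 //; lra.
by apply: ler_weXn2l => //; lra.
Qed.

(** * Counting the simplices that contain a point *)

Lemma card_near (b x : R) : 2 <= b ->
  (#|[set t : 'I_n | (x < 2 * b ^+ t)%R && (b ^+ t < b * x)%R]| <= 2)%N.
Proof.
move=> b2; set N := [set t | _].
(* Any two near exponents differ by at most 1, so all of them are the least one or its successor. *)
have close (s t : 'I_n) : s \in N -> t \in N -> (t < s.+2)%N.
  rewrite !inE => /andP[xs _] /andP[_ tx]; rewrite ltnNge; apply/negP => st.
  have : b ^+ s.+2 <= b ^+ t by apply: ler_weXn2l => //; lra.
  apply/negP; rewrite -ltNge; apply: (lt_trans tx).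
  rewrite exprS ltr_pM2l; last by lra.
  by apply: (lt_le_trans xs); rewrite exprS ler_pM2r // exprn_gt0 //; lra.
have [->|[s0 s0N]] := set_0Vmem N; first by rewrite cards0.
have [s sN smin] := arg_minnP (fun t : 'I_n => t : nat) s0N.
have next t : t \in N :\ s -> t = s.+1 :> nat.
  rewrite in_setD1 => /andP[ts tN].
  apply/anti_leq; rewrite -ltnS close //= ltn_neqAle eq_sym.
  by rewrite (smin t tN) andbT.
rewrite (cardsD1 s) (sN : s \in N) add1n ltnS; apply/card_le1_eqP => t t' tN t'N.
by apply/val_inj; rewrite /= (next t) ?(next t').
Qed.

Lemma stretched_diagonal_inj d :
  (2 <= d)%N -> injective (stretched_diagonal d).
Proof.
case: d => // d _ i j /(congr1 (fun v : 'rV_d.+1 => v 0 0)).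
have b2 := baseS_ge2 0; rewrite !mxE => /ieexprIn eij.
by apply/val_inj/eij; [lra | apply/eqP; lra].
Qed.

Lemma num_simplices_stretched_diagonal d (p : 'rV[R]_d) :
  (num_simplices_containing (stretched_diagonal d) p)%:R
    <= (n%:R / d.+1%:R) ^+ d.+1 + (d * 2)%:R * n%:R ^+ d :> R.
Proof.
(* The disjunct [j == ord0] provides the default candidate for the maximum that defines [lev]. *)
pose above (t : 'I_n) (j : 'I_d.+1) :=
  (j == ord0) || (base j * hcoord p j <= base j ^+ t).
pose lev (t : 'I_n) : 'I_d.+1 := [arg max_(j > ord0 | above t j) (j : nat)].
pose near (k : 'I_d) : {set 'I_n} :=
  let j := lift ord0 k in
  [set t : 'I_n | (hcoord p j < 2 * base j ^+ t)
        && (base j ^+ t < base j * hcoord p j)].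
pose N := \bigcup_(k < d) near k.
have cardN : (#|N| <= d * 2)%N.
  apply: (@leq_trans (\sum_(k < d) #|near k|)%N).
    rewrite /N; elim/big_rec2: _ => [|k m A _ IH]; first by rewrite cards0.
    by apply: leq_trans (leq_card_setU _ _) _; rewrite leq_add2l.
  rewrite -[leqRHS](_ : (\sum_(k < d) 2 = d * 2)%N); last first.
    by rewrite sum_nat_const card_ord.
  apply: leq_sum => k _.
  exact/card_near/baseS_ge2.
set A := [set T : {set 'I_n} | (#|T| == d.+1)
        && [forall j, [exists t in T, lev t == j]]].
set B := [set T : {set 'I_n} | (#|T| == d.+1) && (T :&: N != set0)].
have sub : [set T : {set 'I_n} | (#|T| == d.+1)
    && `[< in_hull (stretched_diagonal d) T p >]] \subset A :|: B.
  apply/subsetP => T; rewrite !inE => /andP[-> /asboolP pT] /=.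
  rewrite orbC; apply/orP; case: (altP eqP) => [TN|]; [right|by left].
  apply/forallP => j; apply/existsP.
  have [t tT [low high]] := hull_vertex d T p pT j.
  exists t; rewrite tT /lev /=.
  (* The vertex is not below [p] in coordinate [j] and, not being near, is above it; [high] excludes
     every later coordinate, so its level is exactly [j]. *)
  have jt : above t j.
    rewrite /above; case: (unliftP ord0 j) => [k|] ej; last by rewrite ej.
    rewrite orbC leNgt; apply/orP; left; apply/negP => jlow.
    have : t \in T :&: N.
      rewrite inE tT; apply/bigcupP; exists k => //.
      by rewrite inE -ej low jlow.
    by rewrite TN inE.
  case: arg_maxnP => [|k kt kmax]; first by rewrite /above eqxx.
  rewrite -val_eqE eqn_leq (kmax j jt : (j <= k)%N) andbT leqNgt; apply/negP => jk.
  case/orP: kt => [/eqP k0|]; first by rewrite k0 in jk.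
  by rewrite leNgt high.
have le_nat : (num_simplices_containing (stretched_diagonal d) p
    <= \prod_(j < d.+1) #|[set t | lev t == j]| + d * 2 * n ^ d)%N.
  apply: leq_trans (subset_leq_card sub) _.
  apply: leq_trans (leq_card_setU _ _) _; apply: leq_add.
    exact: card_transversals.
  apply: leq_trans (card_subsets_meeting N d) _.
  by rewrite leq_mul2r cardN orbT.
have : (num_simplices_containing (stretched_diagonal d) p)%:R
  <= (\prod_(j < d.+1) #|[set t | lev t == j]| + d * 2 * n ^ d)%N%:R :> R.
  by rewrite ler_nat.
move=> /le_trans; apply.
by rewrite natrD natrM natrX lerD2r prod_fibers_le.
Qed.

End Bases.

Theorem theorem3 (R : realType) (d : nat) (hd : (2 <= d)%N) :
  exists C : R, forall n : nat, (0 < n)%N ->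
    exists f : 'I_n -> 'rV[R]_d,
      [/\ injective f, convex_position f &
          forall p : 'rV[R]_d,
            (num_simplices_containing f p)%:R
              <= (n%:R / d.+1%:R) ^+ d.+1 + C * n%:R ^+ d].
Proof.
(* Two near exponents for each of the [d] coordinates. *)
exists (d * 2)%:R => n _; exists (stretched_diagonal R n d); split.
- exact: stretched_diagonal_inj.
- exact: stretched_diagonal_convex.
- exact: num_simplices_stretched_diagonal.
Qed.
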